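(* Let $g_1,g_2$ be firm carcass maps and let $h:[0,1]\to[0,1]$ be their conjugacy, i.e. the homeomorphism with $h\circ g_1=g_2\circ h$. If $h$ is not piecewise linear, then the length of the graph of $h$ equals $2$.
   Context: A unimodal map is a continuous map $g:[0,1]\to[0,1]$ for which there is $v\in(0,1)$ such that $g$ is strictly increasing on $[0,v]$, strictly decreasing on $[v,1]$, and $g(0)=g(1)=0$, $g(v)=1$. The complete pre-image of $0$ is $g^{-\infty}(0)=\bigcup_{n\ge1}\{x\in[0,1]:g^n(x)=0\}$, where $g^n$ is the $n$-th iterate. A map is piecewise linear if its domain can be divided into finitely many intervals on each of which its graph is a line segment; a kink is a point where a piecewise linear map is not differentiable (interior points of $[0,1]$ are meant). A carcass map is a piecewise linear unimodal map; a firm carcass map is a carcass map all of whose kinks belong to $g^{-\infty}(0)$. For any two firm carcass maps the conjugacy $h$ exists, is unique and increasing. The length of the graph is the usual arc length (supremum of lengths of inscribed polygonal lines). *)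

(* Defs.v *)
From HB Require Import structures.
From mathcomp Require Import all_boot all_order all_algebra.
From mathcomp Require Import all_classical all_reals all_analysis.

Set Implicit Arguments.
Unset Strict Implicit.
Unset Printing Implicit Defensive.

Import Order.TTheory GRing.Theory Num.Theory.
Import numFieldNormedType.Exports.

Local Open Scope classical_set_scope.
Local Open Scope ring_scope.

(* A self-map of the unit interval is a function R -> R whose values outside
   [0, 1] are irrelevant: no definition below depends on them. *)

Definition homeomorphism {T U : topologicalType} (A : set T) (B : set U)
    (f : T -> U) : Prop :=
  [/\ set_fun A B f, {within A, continuous f} &
    exists g : U -> T,
      [/\ set_fun B A g, {within B, continuous g},
          {in A, cancel f g} & {in B, cancel g f}]].

Section carcass.
Context {R : realType}.
Implicit Types (a b : R) (f g h : R -> R) (s : seq R).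

Definition unimodal g : Prop :=
  [/\ set_fun `[0, 1] `[0, 1] g, {within `[0, 1], continuous g} &
    exists2 v : R, v \in `]0, 1[ &
      [/\ {in `[0, v] &, {homo g : x y / x < y}},
          {in `[v, 1] &, {homo g : x y /~ x < y}},
          g 0 = 0, g 1 = 0 & g v = 1]].

Definition zero_preimages g : set R :=
  \bigcup_(n in [set n : nat | (1 <= n)%N])
    [set x | x \in `[0, 1] /\ iter n g x = 0].

(* In itv_partition a b s the sequence s omits the left endpoint a, so the
   successive nodes are those of a :: s. *)
Definition piecewise_linear a b f : Prop :=
  exists2 s : seq R, itv_partition a b s &
    forall i : nat, (i < size s)%N ->
      exists k c : R, {in `[nth b (a :: s) i, nth b (a :: s) i.+1],
        forall x, f x = k * x + c}.

Definition kinks g : set R :=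
  [set x | (x \in `]0, 1[) /\ ~ derivable g x 1].

Definition carcass g : Prop := unimodal g /\ piecewise_linear 0 1 g.

Definition firm_carcass g : Prop :=
  carcass g /\ kinks g `<=` zero_preimages g.

Definition conjugacy g1 g2 h : Prop :=
  homeomorphism (`[0, 1] : set R) (`[0, 1] : set R) h /\
  {in `[0, 1], forall x, h (g1 x) = g2 (h x)}.

Definition polygonal_length a b f s : R :=
  let X := nth b (a :: s) in
  \sum_(0 <= i < size s)
    Num.sqrt ((X i.+1 - X i) ^+ 2 + (f (X i.+1) - f (X i)) ^+ 2).

Definition graph_length a b f : \bar R :=
  ereal_sup [set (polygonal_length a b f s)%:E | s in itv_partition a b].

End carcass.

(* Main.v *)
Require Import Defs.
From mathcomp Require Import all_boot all_order all_algebra.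
From mathcomp Require Import all_classical all_reals all_analysis.
From mathcomp Require Import ring lra.

Import Order.TTheory GRing.Theory Num.Theory.
Import numFieldNormedType.Exports.

Local Open Scope classical_set_scope.
Local Open Scope ring_scope.

(** Inverse branches of a firm carcass map cut [0, 1] into cylinders, one for
    each binary word; the cylinder of w is cut in two by the image of the
    turning point. An increasing conjugacy h carries the cylinders of g1 to
    those of g2 (conjugacy_cyl), so that h is known through the lengths l1 w and l2 w of
    the two cylinders of each word.

    Firmness makes g affine on all cylinders of large depth
    (firm_affine_on_cyl): their interiors contain no zero of the first iterates
    and hence no kink. Therefore the ratio in which the cylinder of a long
    word is cut depends only on its last N letters (firm_self_similar), and only
    finitely many ratios occur. If the ratios of g1 and g2 agree at all words of
    length at least N, then h is affine on each cylinder of depth N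
    (balanced_affine_on_cyl), and so is piecewise linear.

    Otherwise they differ at some word w0, and h is singular in the following
    quantitative sense. Let S n be the sum of sqrt (l1 w * l2 w) over the words
    of length n. By the Cauchy-Schwarz inequality S never increases, with a
    strict loss at each cylinder cut in different ratios. A copy of w0 lies at
    bounded depth below each cylinder, and by self-similarity it takes away a
    fixed proportion of the sum, so S n tends to 0 (affinity_vanishes). Finally

      x + y - sqrt 2 * sqrt (x * y) <= sqrt (x^2 + y^2) <= x + y,

    applied to the chords over the cylinders of depth n, shows that the
    inscribed polygonal line has length at least 2 - sqrt 2 * S n
    (cyl_polygonal_length), while no inscribed line is longer than
    (1 - 0) + (h 1 - h 0) = 2. *)

(** * Lengths and Hellinger affinities on the binary tree *)

Section cylinder_trees.
Set Implicit Arguments.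
Unset Strict Implicit.
Context {R : realType}.
Implicit Types (l : seq bool -> R) (w v u : seq bool) (n N : nat).

(** There are finitely many words of each length. *)
Lemma words_lower_bound (F : seq bool -> R) n :
  (forall w, size w = n -> 0 < F w) ->
  exists2 c, 0 < c & forall w, size w = n -> c <= F w.
Proof.
elim: n F => [|n IHn] F F0.
  by exists (F [::]) => [|w /size0nil ->//]; exact: F0.
have [b bn|c0 c0_gt0 F_c0] := IHn (F \o cons false).
  by apply: F0; rewrite /= bn.
have [b bn|c1 c1_gt0 F_c1] := IHn (F \o cons true).
  by apply: F0; rewrite /= bn.
exists (Num.min c0 c1) => [|[|[] w]//= [wn]]; first by rewrite lt_min c0_gt0.
  by rewrite ge_min F_c1 ?orbT.
by rewrite ge_min F_c0.
Qed.

Lemma geometric_small (c x e : R) : 0 <= c < 1 -> 0 < e ->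
  exists n, c ^+ n * x < e.
Proof.
move=> /andP[c0 c1] e0; have : (fun n => c ^+ n * x) @ \oo --> (0 : R).
  rewrite -(mul0r x); apply: cvgMl; apply: cvg_expr.
  by rewrite ger0_norm.
move=> /cvgrPdist_lt /(_ e e0) [n _ /(_ n (leqnn n))] /=.
by rewrite sub0r normrN => /(le_lt_trans (ler_norm _)); exists n.
Qed.

(** Cauchy-Schwarz in the plane, with a, b, a', b' the square roots of
    x, y, x', y': the squares of the two sides differ by (a b' - a' b)^2. *)
Lemma sqrtM_superadditive (x y x' y' : R) :
  0 < x -> 0 < y -> 0 < x' -> 0 < y' ->
  Num.sqrt (x * y) + Num.sqrt (x' * y') <= Num.sqrt ((x + x') * (y + y'))
    ?= iff (x * y' == x' * y).
Proof.
move=> x0 y0 x'0 y'0.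
have [a [a0 ->]] : exists a, 0 < a /\ x = a ^+ 2.
  by exists (Num.sqrt x); rewrite sqrtr_gt0 sqr_sqrtr ?ltW.
have [b [b0 ->]] : exists b, 0 < b /\ y = b ^+ 2.
  by exists (Num.sqrt y); rewrite sqrtr_gt0 sqr_sqrtr ?ltW.
have [a' [a'0 ->]] : exists a, 0 < a /\ x' = a ^+ 2.
  by exists (Num.sqrt x'); rewrite sqrtr_gt0 sqr_sqrtr ?ltW.
have [b' [b'0 ->]] : exists b, 0 < b /\ y' = b ^+ 2.
  by exists (Num.sqrt y'); rewrite sqrtr_gt0 sqr_sqrtr ?ltW.
rewrite -!exprMn !sqrtr_sqr !gtr0_norm ?mulr_gt0//.
have s0 : 0 < a * b + a' * b' by rewrite addr_gt0 ?mulr_gt0.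
rewrite -[a * b + a' * b']gtr0_norm// -sqrtr_sqr.
have E : (a ^+ 2 + a' ^+ 2) * (b ^+ 2 + b' ^+ 2) =
    (a * b + a' * b') ^+ 2 + (a * b' - a' * b) ^+ 2 by ring.
have T0 : 0 <= (a * b' - a' * b) ^+ 2 by exact: sqr_ge0.
split; first by rewrite ler_wsqrtr// E lerDl.
rewrite eqr_sqrt ?sqr_ge0 ?E ?addr_ge0 ?sqr_ge0//.
rewrite -subr_eq0 opprD addrA subrr add0r oppr_eq0 sqrf_eq0 subr_eq0.
by rewrite eqrXn2 ?mulr_ge0 ?ltW.
Qed.

(** A word names a node of the binary tree and rcons goes down to a child, so a
    splitting function is a mass that each node shares between its children. *)
Definition splitting l : Prop :=
  (forall w, 0 < l w) /\
  (forall w, l w = l (rcons w false) + l (rcons w true)).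

(** Below any node the mass is, up to a factor, distributed as it is below the
    node named by the last N letters. Prefixing a word is what the inverse
    branches of a map do, hence the roles of w and v. *)
Definition self_similar N l : Prop :=
  forall w v, size v = N ->
    exists2 k, 0 < k & forall u, l (w ++ v ++ u) = k * l (v ++ u).

(** An equal split hands the quotient of the two masses at a node down to both
    of its children. *)
Lemma balanced_proportional l l' w : splitting l -> splitting l' ->
  (forall u, l (rcons (w ++ u) false) * l' (rcons (w ++ u) true) =
             l (rcons (w ++ u) true) * l' (rcons (w ++ u) false)) ->
  forall u, l' (w ++ u) = l' w / l w * l (w ++ u).
Proof.
move=> [l0 lD] [l'0 l'D] bal.
elim/last_ind => [|u b IHu]; first by rewrite cats0 divfK// gt_eqF.
rewrite -rcons_cat; set k := l' w / l w in IHu *; set x := w ++ u in IHu bal *.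
apply: (mulIf (lt0r_neq0 (l0 x))).
have E : l' (rcons x b) * l x = l (rcons x b) * l' x.
  have := bal u; rewrite -/x (lD x) (l'D x).
  by case: b; lra.
by rewrite E IHu; ring.
Qed.

(** The Hellinger affinity of the two masses, seen at depth n below w. *)
Fixpoint affinity l l' n w : R :=
  if n is m.+1 then
    affinity l l' m (rcons w false) + affinity l l' m (rcons w true)
  else Num.sqrt (l w * l' w).

Lemma affinity_ge0 l l' n w : 0 <= affinity l l' n w.
Proof. by elim: n w => [|n IHn] w /=; rewrite ?sqrtr_ge0// addr_ge0. Qed.

Lemma affinity1 l l' w : splitting l -> splitting l' ->
  affinity l l' 1 w <= affinity l l' 0 w ?= iff
    (l (rcons w false) * l' (rcons w true) ==
     l (rcons w true) * l' (rcons w false)).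
Proof.
move=> [l0 lD] [l'0 l'D] /=; rewrite (lD w) (l'D w).
by apply: sqrtM_superadditive.
Qed.

Lemma affinity_le0 l l' n w : splitting l -> splitting l' ->
  affinity l l' n w <= affinity l l' 0 w.
Proof.
move=> sl sl'; elim: n w => [|n IHn] w //.
have [w1 _] := affinity1 w sl sl'.
by apply: le_trans w1; rewrite /= lerD// IHn.
Qed.

Lemma affinity_add l l' n k c w :
  (forall u, size u = n ->
     affinity l l' k (w ++ u) <= c * affinity l l' 0 (w ++ u)) ->
  affinity l l' (n + k) w <= c * affinity l l' n w.
Proof.
elim: n w => [|n IHn] w H; first by move: (H [::] erefl); rewrite cats0.
by rewrite addSn /= mulrDr lerD// IHn// => u un;
  rewrite cat_rcons; apply: H; rewrite /= un.
Qed.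

(** The affinity never increases with the depth, so the loss at a single node
    w ++ u is a loss for the whole tree below w. *)
Lemma affinity_defect l l' u w : splitting l -> splitting l' ->
  affinity l l' (size u).+1 w <=
    affinity l l' 0 w - (affinity l l' 0 (w ++ u) - affinity l l' 1 (w ++ u)).
Proof.
move=> sl sl'; elim: u w => [|b u IHu] w; first by rewrite cats0 subKr.
rewrite -[affinity _ _ (size (b :: u)).+1 w]/(
  affinity l l' (size u).+1 (rcons w false) +
  affinity l l' (size u).+1 (rcons w true)).
have w1 := (affinity1 w sl sl').1.
have := IHu (rcons w b); rewrite cat_rcons.
have := affinity_le0 (size u).+1 (rcons w (~~ b)) sl sl'.
move: w1; rewrite -[affinity l l' 1 w]/(
  affinity l l' 0 (rcons w false) + affinity l l' 0 (rcons w true)).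
by case: b => /=; lra.
Qed.

(** Self-similarity reduces the strict inequality F < G to the finitely many
    nodes at depth N, which makes it uniform. *)
Lemma self_similar_contraction (F G : seq bool -> R) N :
  (forall w v, size v = N -> exists2 k, 0 < k &
     F (w ++ v) = k * F v /\ G (w ++ v) = k * G v) ->
  (forall v, size v = N -> 0 <= F v < G v) ->
  exists2 c, 0 <= c < 1 & forall w, (N <= size w)%N -> F w <= c * G w.
Proof.
move=> scale FG.
have [v vN|c0 c0_gt0 Fc0] :=
    words_lower_bound (F := fun v => 1 - F v / G v) (n := N).
  have /andP[F0 lt_FG] := FG v vN.
  by rewrite subr_gt0 ltr_pdivrMr ?mul1r// (le_lt_trans F0).
have bound v : size v = N -> F v <= (1 - c0) * G v.
  move=> vN; have /andP[F0 lt_FG] := FG v vN.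
  rewrite -ler_pdivrMr; last exact: le_lt_trans lt_FG.
  by rewrite lerBrDr addrC -lerBrDr Fc0.
exists (1 - c0).
  rewrite subr_ge0 gtrDl oppr_lt0 c0_gt0 andbT.
  have vN := size_nseq N true; have /andP[F0 lt_FG] := FG _ vN.
  apply: le_trans (Fc0 _ vN) _; rewrite gerDl oppr_le0 divr_ge0//.
  exact: le_trans (ltW lt_FG).
move=> w Nw; rewrite -(cat_take_drop (size w - N) w).
have vN : size (drop (size w - N) w) = N by rewrite size_drop subKn.
have [k k0 [-> ->]] := scale (take (size w - N) w) _ vN.
by rewrite mulrCA ler_pM2l// bound.
Qed.

(** A child has strictly less mass than its parent, by a uniform factor. *)
Lemma splitting_shrink l N w e :
  splitting l -> self_similar N l -> (N <= size w)%N -> 0 < e ->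
  exists n, forall u, size u = n -> l (w ++ u) < e.
Proof.
move=> [l0 lD] ssl Nw e0.
have shrink b : exists2 c, 0 <= c < 1 &
    forall w, (N <= size w)%N -> l (rcons w b) <= c * l w.
  apply: (self_similar_contraction (F := fun w => l (rcons w b))).
    move=> v1 v2 v2N; have [k k0 lk] := ssl v1 v2 v2N.
    exists k => //; rewrite -!cats1 -catA lk; split => //.
    by have := lk [::]; rewrite !cats0.
  move=> v _; rewrite ltW//= (lD v).
  by case: b; rewrite ?ltrDl ?ltrDr.
have [c0 /andP[c00 c01] lc0] := shrink false.
have [c1 /andP[c10 c11] lc1] := shrink true.
pose c := Num.max c0 c1.
have cP : 0 <= c < 1 by rewrite le_max c00/= gt_max c01 c11.
have lc v b : (N <= size v)%N -> l (rcons v b) <= c * l v.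
  move=> Nv; case: b; apply: le_trans (_ : _ <= _ * l v) _.
  - exact: lc1.
  - by rewrite ler_pM2r ?l0// le_max lexx orbT.
  - exact: lc0.
  - by rewrite ler_pM2r ?l0// le_max lexx.
have [n cn] := geometric_small (l w) cP e0.
exists n => u un; apply: le_lt_trans cn; rewrite -un {un n}.
elim/last_ind: u => [|u b IHu]; first by rewrite cats0 mul1r.
rewrite -rcons_cat size_rcons exprS -mulrA.
apply: le_trans (lc _ _ _) _; 
  first by rewrite size_cat (leq_trans Nw)// leq_addr.
by rewrite ler_wpM2l//; case/andP: cP.
Qed.

(** A copy of the unequal split at w0 lies at bounded depth below every node,
    where it costs a definite proportion of the affinity, uniformly by
    self-similarity; so the affinity decays geometrically. *)
Lemma affinity_vanishes l l' N w0 e :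
  splitting l -> splitting l' -> self_similar N l -> self_similar N l' ->
  (N <= size w0)%N ->
  l (rcons w0 false) * l' (rcons w0 true) !=
  l (rcons w0 true) * l' (rcons w0 false) ->
  0 < e -> exists n, affinity l l' n [::] < e.
Proof.
move=> sl sl' ssl ssl' Nw0 w0_neq e0.
(* the copy of w0 below w has the same unequal split, the masses at both nodes
   being multiples of those below the last N letters of w0 *)
have strict w : affinity l l' (size w0).+1 w < affinity l l' 0 w.
  apply: le_lt_trans (affinity_defect w0 w sl sl') _.
  rewrite ltrBlDr ltrDl subr_gt0 (lt_leif (affinity1 _ sl sl')).
  rewrite -[w0](cat_take_drop (size w0 - N)).
  set t := take _ _; set v := drop _ _.
  have vN : size v = N by rewrite size_drop subKn.
  rewrite catA.
  have [k k0 lk] := ssl (w ++ t) v vN; have [k' k'0 lk'] := ssl' (w ++ t) v vN.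
  have [m m0 lm] := ssl t v vN; have [m' m'0 lm'] := ssl' t v vN.
  move: w0_neq; rewrite -[w0](cat_take_drop (size w0 - N)) -/t -/v.
  rewrite -!cats1 -!(catA _ v).
  rewrite !lk !lk' !lm !lm' !(mulrACA m _ m') !(mulrACA k _ k').
  have mm' : m * m' != 0 by rewrite mulf_neq0 ?gt_eqF.
  have kk' : k * k' != 0 by rewrite mulf_neq0 ?gt_eqF.
  by rewrite (inj_eq (mulfI mm')) (inj_eq (mulfI kk')).
have [w v vN|v vN|c /andP[c0 c1] Fc] := self_similar_contraction
    (F := affinity l l' (size w0).+1) (G := affinity l l' 0) (N := N).
- have [k k0 lk] := ssl w v vN; have [k' k'0 lk'] := ssl' w v vN.
  exists (Num.sqrt (k * k')); first by rewrite sqrtr_gt0 mulr_gt0.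
  suff scale n u : affinity l l' n (w ++ v ++ u) =
      Num.sqrt (k * k') * affinity l l' n (v ++ u).
    by split; have := scale _ [::]; rewrite !cats0; apply.
  elim: n u => [|n IHn] u; last by rewrite /= !rcons_cat !IHn mulrDr.
  by rewrite /= lk lk' -sqrtrM ?mulr_ge0 ?ltW//; congr Num.sqrt; ring.
- by rewrite affinity_ge0 strict.
have c01 : 0 <= c < 1 by rewrite c0.
have [n cn] := geometric_small (affinity l l' N [::]) c01 e0.
(* the first N levels are excluded from the uniform contraction *)
exists (N + n * (size w0).+1)%N; apply: le_lt_trans cn.
elim: n => [|n IHn]; first by rewrite addn0 mul1r.
rewrite mulSnr addnA exprS -mulrA.
apply: le_trans (_ : c * affinity l l' (N + n * (size w0).+1) [::] <= _).
  apply: affinity_add => u un; apply: Fc.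
  by rewrite cat0s un leq_addr.
by rewrite ler_wpM2l.
Qed.

End cylinder_trees.

(** * Piecewise linear functions and polygonal lengths *)

Section piecewise_affine.
Context {R : realType}.
Set Implicit Arguments.
Unset Strict Implicit.
Implicit Types (f : R -> R) (a b c p q : R) (s : seq R).

Definition affine_on a b f : Prop :=
  exists k c : R, {in `[a, b], forall x, f x = k * x + c}.

(** The one-sided slopes both equal the derivative at c. *)
Lemma affine_on_derivable_join a c b f : a < c -> c < b ->
  affine_on a c f -> affine_on c b f -> derivable f c 1 -> affine_on a b f.
Proof.
move=> ac cb [k1 [c1 f1]] [k2 [c2 f2]] /cvg_ex[d /cvgrPdist_lt fd].
have fc1 : f c = k1 * c + c1 by rewrite f1// in_itv/= lexx ltW.
have fc2 : f c = k2 * c + c2 by rewrite f2// in_itv/= lexx ltW.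
suff k12 : k1 = k2.
  exists k1, c1 => x; rewrite in_itv/= => /andP[ax xb].
  have [xc|cx] := leP x c; first by rewrite f1// in_itv/= ax.
  rewrite f2 ?in_itv/= ?(ltW cx)// k12; congr (_ + _).
  by move: fc1; rewrite fc2 k12 => /addrI.
apply/eqP; apply: contraT => k12.
(* the derivative d is within half of |k1 - k2| of the slopes on both sides *)
have e0 : 0 < `|k1 - k2| / 2 by rewrite divr_gt0// normr_gt0 subr_eq0.
have [r /= r0 fr] := fd _ e0.
pose t := Num.min r (Num.min (b - c) (c - a)) / 2.
have m0 : 0 < Num.min r (Num.min (b - c) (c - a)).
  by rewrite !lt_min !subr_gt0 r0 ac cb.
have t0 : 0 < t by rewrite divr_gt0.
have tm : t < Num.min r (Num.min (b - c) (c - a)).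
  by rewrite /t ltr_pdivrMr// ltr_pMr// ltr1n.
move: tm; rewrite !lt_min => /and3P[tr tb ta].
have quot h k e : h != 0 -> f (h *: 1 + c) = k * (h *: 1 + c) + e ->
    f c = k * c + e ->
    h^-1 *: (f (h *: 1 + c) - f c) = k.
  move=> h0 -> ->; rewrite /GRing.scale/=; field.
  exact: h0.
have dt : `|d - k2| < `|k1 - k2| / 2.
  have := fr t; rewrite /= (quot t k2 c2) ?gt_eqF//; last first.
    by rewrite f2// in_itv/= /GRing.scale/= mulr1; apply/andP; split; lra.
  by apply => //; rewrite sub0r normrN gtr0_norm.
have dN : `|d - k1| < `|k1 - k2| / 2.
  have := fr (- t).
  rewrite /= (quot (- t) k1 c1) ?oppr_eq0 ?gt_eqF//; last first.
    by rewrite f1// in_itv/= /GRing.scale/= mulr1; apply/andP; split; lra.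
  by apply; rewrite ?oppr_eq0 ?gt_eqF// sub0r opprK gtr0_norm.
have : `|k1 - k2| <= `|d - k2| + `|d - k1|.
  rewrite (_ : k1 - k2 = (d - k2) - (d - k1)); last by ring.
  exact: ler_normB.
by lra.
Qed.

Lemma affine_onS a b p q f : a <= p -> q <= b ->
  affine_on a b f -> affine_on p q f.
Proof.
move=> ap qb [k [c fE]]; exists k, c => x; rewrite in_itv/= => /andP[px xq].
by rewrite fE// in_itv/= (le_trans ap)// (le_trans xq).
Qed.

(** Differentiability at a node rules out a change of slope there, so the pieces
    between p and q glue together. *)
Lemma pieces_derivable_affine_on s a b f p q :
  itv_partition a b s ->
  (forall i, (i < size s)%N ->
     affine_on (nth b (a :: s) i) (nth b (a :: s) i.+1) f) ->
  a <= p -> p < q -> q <= b ->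
  {in s, forall x, p < x < q -> derivable f x 1} ->
  affine_on p q f.
Proof.
elim: s a p => [|c s IHs] a p abs affs ap pq qb ders.
  move: ap; rewrite (itv_partition_nil abs) => bp.
  by have := lt_le_trans (le_lt_trans bp pq) qb; rewrite ltxx.
have affc := affs 0%N erefl.
have {}IHs p' : c <= p' -> p' < q -> p <= p' -> affine_on p' q f.
  move=> cp' p'q pp'; apply: (IHs c) => //.
  - exact: itv_partition_cons abs.
  - by move=> i; exact: (affs i.+1).
  - move=> x xs /andP[p'x xq]; apply: ders; first by rewrite inE xs orbT.
    by rewrite xq andbT (le_lt_trans pp').
have [cp|pc] := leP c p; first exact: IHs.
have [qc|cq] := leP q c; first exact: affine_onS affc.
apply: (affine_on_derivable_join pc cq).
- exact: affine_onS affc.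
- exact: IHs (lexx c) cq (ltW pc).
- by apply: ders; rewrite ?mem_head// pc.
Qed.

Lemma piecewise_linear_affine a b f : a < b ->
  affine_on a b f -> piecewise_linear a b f.
Proof.
by move=> ab fE; exists [:: b] => [|[]//]; exact: itv_partition1.
Qed.

Lemma piecewise_linear_cat a c b f :
  piecewise_linear a c f -> piecewise_linear c b f -> piecewise_linear a b f.
Proof.
move=> [s acs fs] [t cbt ft].
exists (s ++ t); first exact: itv_partition_cat cbt.
elim: s a acs fs => [|d s IHs] a acs fs /=.
  by rewrite (itv_partition_nil acs).
case=> [_|i /IHs]; first exact: fs 0%N erefl.
by apply; [exact: itv_partition_cons acs|move=> j; exact: (fs j.+1)].
Qed.

Lemma polygonal_length_nil a b f : polygonal_length a b f [::] = 0.
Proof. exact: big_geq. Qed.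

Lemma polygonal_length_cons a b f c s :
  polygonal_length a b f (c :: s) =
  Num.sqrt ((c - a) ^+ 2 + (f c - f a) ^+ 2) + polygonal_length c b f s.
Proof.
by rewrite /polygonal_length /= big_nat_recl.
Qed.

Lemma polygonal_length_cat a c b f s t : itv_partition a c s ->
  polygonal_length a b f (s ++ t) =
  polygonal_length a c f s + polygonal_length c b f t.
Proof.
elim: s a => [|d s IHs] a acs.
  by rewrite (itv_partition_nil acs) polygonal_length_nil add0r.
by rewrite /= !polygonal_length_cons (IHs _ (itv_partition_cons acs)) addrA.
Qed.

Lemma sqrt_sum_le_add (x y : R) : 0 <= x -> 0 <= y ->
  Num.sqrt (x ^+ 2 + y ^+ 2) <= x + y.
Proof.
move=> x0 y0; rewrite -[leRHS]ger0_norm ?addr_ge0// -sqrtr_sqr.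
by apply: ler_wsqrtr; rewrite sqrrD lerD2r lerDl mulrn_wge0// mulr_ge0.
Qed.

(** A graph segment falls short of the sum of its two legs by at most a multiple
    of their geometric mean; summed up, this bounds the defect of a polygonal
    length by an affinity. *)
Lemma sqrt_sum_ge_add (x y : R) : 0 <= x -> 0 <= y ->
  x + y - Num.sqrt 2 * Num.sqrt (x * y) <= Num.sqrt (x ^+ 2 + y ^+ 2).
Proof.
move=> x0 y0; rewrite -sqrtrM//; set m := Num.sqrt (2 * _).
have m0 : 0 <= m by exact: sqrtr_ge0.
have mE : m ^+ 2 = 2 * (x * y) by rewrite sqr_sqrtr// !mulr_ge0.
have mxy : m <= x + y.
  by rewrite -(ler_pXn2r (ltn0Sn 1)) ?nnegrE ?addr_ge0// mE; nra.
rewrite -[leLHS]ger0_norm ?subr_ge0// -sqrtr_sqr; apply: ler_wsqrtr.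
by nra.
Qed.

Lemma polygonal_length_le a b f s :
  {in `[a, b] &, {homo f : x y / x <= y}} -> itv_partition a b s ->
  polygonal_length a b f s <= (b - a) + (f b - f a).
Proof.
elim: s a => [|c s IHs] a ndf abs.
  by rewrite (itv_partition_nil abs) polygonal_length_nil !subrr addr0.
have cbs := itv_partition_cons abs; have cb := itv_partition_le cbs.
have /andP[ac _] : (a < c) && path <%R c s by case: abs.
rewrite polygonal_length_cons.
have fac : f a <= f c.
  by apply: ndf; rewrite ?in_itv/= ?lexx ?(ltW ac)// (le_trans (ltW ac)).
have := sqrt_sum_le_add (x := c - a) (y := f c - f a).
rewrite !subr_ge0 => /(_ (ltW ac) fac) H1.
have := IHs c _ cbs; rewrite addrACA in H1 *.
move=> H2; apply: le_trans (lerD H1 (H2 _)) _; last by lra.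
by move=> x y; rewrite !in_itv/= => /andP[cx xb] /andP[cy yb] xy;
  apply: ndf; rewrite ?in_itv/= ?xb ?yb ?andbT ?(le_trans (ltW ac)).
Qed.

End piecewise_affine.

(** * Inverse branches of a unimodal map and their cylinders *)

Section inverse_branches.
Context {R : realType}.
Set Implicit Arguments.
Unset Strict Implicit.
Implicit Types (g h : R -> R) (v x y : R) (phi : bool -> R -> R).
Implicit Types (w u : seq bool) (b : bool).

(** The two inverse branches phi false, increasing onto [0, v], and phi true,
    decreasing onto [v, 1], of a unimodal map g with turning point v. *)
Record inverse_branches g v phi : Prop := InverseBranches {
  branch_turn : 0 < v < 1;
  branch_map : forall x, x \in `[0, 1] -> g x \in `[0, 1];
  branch_in : forall b y, y \in `[0, 1] -> phi b y \in `[0, 1];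
  branchK : forall b, {in `[0, 1], cancel (phi b) g};
  branch_inc : {in `[0, 1] &, {homo phi false : x y / x < y}};
  branch_dec : {in `[0, 1] &, {homo phi true : x y /~ x < y}};
  branch_false0 : phi false 0 = 0;
  branch_true0 : phi true 0 = 1;
  branch1 : forall b, phi b 1 = v;
  branch_falseK : {in `[0, v], cancel g (phi false)};
  branch_trueK : {in `[v, 1], cancel g (phi true)} }.

Lemma unimodal_inverse_branches g : unimodal g ->
  exists v phi, inverse_branches g v phi.
Proof.
move=> [gin gcont [v v01 [ginc gdec g0 g1 gv]]].
have /andP[v0 v1] : 0 < v < 1 by rewrite in_itv in v01.
have zv01 x : x \in `[0, v] -> x \in `[0, 1].
  by rewrite !in_itv/= => /andP[-> xv]; rewrite (le_trans xv)// ltW.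
have v101 x : x \in `[v, 1] -> x \in `[0, 1].
  by rewrite !in_itv/= => /andP[vx ->]; rewrite (le_trans (ltW v0)).
pose side b : interval R := if b then `[v, 1] else `[0, v].
have side_preimage (c : bool * R) : exists x,
    c.2 \in `[0, 1] -> x \in side c.1 /\ g x = c.2.
  case: c => -[] y /=; have [|_] := boolP (y \in `[0, 1]); try by exists 0.
  - rewrite in_itv/= => /andP[y0 y1].
    have [|||x xI gx] := @IVT R g v 1 y; first exact: ltW.
    + by apply: continuous_subspaceW gcont => x /=; exact: v101.
    + by rewrite gv g1 ge_min le_max y0 y1 orbT.
    + by exists x.
  - rewrite in_itv/= => /andP[y0 y1].
    have [|||x xI gx] := @IVT R g 0 v y; first exact: ltW.
    + by apply: continuous_subspaceW gcont => x /=; exact: zv01.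
    + by rewrite gv g0 ge_min le_max y0 y1 orbT.
    + by exists x.
have [phi' phi'P] := choice side_preimage.
pose phi b y := phi' (b, y).
have phi_side b y : y \in `[0, 1] -> phi b y \in side b.
  by move=> /(phi'P (b, y))[].
have phiK b y : y \in `[0, 1] -> g (phi b y) = y.
  by move=> /(phi'P (b, y))[].
have ginj0 := inc_inj_in (le_mono_in ginc).
have ginj1 := dec_inj_in (le_nmono_in gdec).
have falseK : {in `[0, v], cancel g (phi false)}.
  move=> x xv; have gx : g x \in `[0, 1] by apply: gin; exact: zv01.
  by apply: ginj0 => //; [exact: (phi_side false)|exact: phiK].
have trueK : {in `[v, 1], cancel g (phi true)}.
  move=> x xv; have gx : g x \in `[0, 1] by apply: gin; exact: v101.
  by apply: ginj1 => //; [exact: (phi_side true)|exact: phiK].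
exists v, phi; split.
- by rewrite v0.
- by move=> x x01; exact: gin.
- move=> b y /(phi_side b); case: b => /=; [exact: v101|exact: zv01].
- by move=> b y; exact: phiK.
- move=> x y x01 y01 xy; rewrite -(leW_mono_in (le_mono_in ginc)) ?phiK//.
    exact: (phi_side false).
  exact: (phi_side false).
- move=> x y x01 y01 xy; rewrite -(leW_nmono_in (le_nmono_in gdec)) ?phiK//.
    exact: (phi_side true).
  exact: (phi_side true).
- by rewrite -[in LHS]g0 falseK// in_itv/= lexx ltW.
- by rewrite -[in LHS]g1 trueK// in_itv/= lexx ltW.
- by case; rewrite -[X in phi _ X]gv ?trueK ?falseK// in_itv/= lexx ltW.
- exact: falseK.
- exact: trueK.
Qed.

(** The word w acts as the composite foldr phi _ w of inverse branches. Its
    image of [0, 1] is a cylinder, an interval between neighbouring zeros of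
    iter (size w).+1 g; the composite may reverse the order, whence the min and
    the max. *)
Definition cyl_lo phi w := Num.min (foldr phi 0 w) (foldr phi 1 w).
Definition cyl_hi phi w := Num.max (foldr phi 0 w) (foldr phi 1 w).
Definition cyl_length phi w := cyl_hi phi w - cyl_lo phi w.

Section cylinders.
Context g v phi (gP : inverse_branches g v phi).

Lemma word_in w x : x \in `[0, 1] -> foldr phi x w \in `[0, 1].
Proof. by move=> x01; elim: w => //= b w; exact: (branch_in gP). Qed.

Lemma word_monotonic w :
  {in `[0, 1] &, {homo (foldr phi)^~ w : x y / x < y}} \/
  {in `[0, 1] &, {homo (foldr phi)^~ w : x y /~ x < y}}.
Proof.
elim: w => [|[] w [IHw|IHw]]; first by left.
- right => x y x01 y01 xy; apply: (branch_dec gP); rewrite ?word_in//.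
  exact: IHw.
- left => x y x01 y01 xy; apply: (branch_dec gP); rewrite ?word_in//.
  exact: IHw.
- left => x y x01 y01 xy; apply: (branch_inc gP); rewrite ?word_in//.
  exact: IHw.
- right => x y x01 y01 xy; apply: (branch_inc gP); rewrite ?word_in//.
  exact: IHw.
Qed.

Let in0 : (0 : R) \in `[0, 1]. Proof. by rewrite in_itv/= lexx ler01. Qed.
Let in1 : (1 : R) \in `[0, 1]. Proof. by rewrite in_itv/= lexx ler01. Qed.
Let inv : v \in `[0, 1].
Proof. by rewrite in_itv/=; case/andP: (branch_turn gP) => /ltW-> /ltW. Qed.

Lemma cyl_endpoints w :
  [/\ cyl_lo phi w = foldr phi 0 w, cyl_hi phi w = foldr phi 1 w &
      {in `[0, 1] &, {homo (foldr phi)^~ w : x y / x < y}}] \/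
  [/\ cyl_lo phi w = foldr phi 1 w, cyl_hi phi w = foldr phi 0 w &
      {in `[0, 1] &, {homo (foldr phi)^~ w : x y /~ x < y}}].
Proof.
rewrite /cyl_lo /cyl_hi.
have [inc|dec] := word_monotonic w; [left|right].
  have lt01 := inc 0 1 in0 in1 ltr01.
  by rewrite min_l ?max_r// ltW.
have lt10 := dec 1 0 in1 in0 ltr01.
by rewrite min_r ?max_l// ltW.
Qed.

Lemma word_in_cyl w y : y \in `[0, 1] ->
  foldr phi y w \in `[cyl_lo phi w, cyl_hi phi w].
Proof.
move=> y01; have /andP[y0 y1] : 0 <= y <= 1 by rewrite in_itv in y01.
rewrite in_itv/=.
have [[-> -> /le_mono_in F]|[-> -> /le_nmono_in F]] := cyl_endpoints w.
  by rewrite !F// y0.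
by rewrite !F// y0 y1.
Qed.

Lemma cyl_in w x : x \in `[cyl_lo phi w, cyl_hi phi w] -> x \in `[0, 1].
Proof.
rewrite !in_itv/= => /andP[lox xhi].
have := word_in w in0; have := word_in w in1; rewrite !in_itv/=.
move: lox xhi; have [[-> -> _]|[-> -> _]] := cyl_endpoints w; lra.
Qed.

Lemma cyl_lt w : cyl_lo phi w < cyl_hi phi w.
Proof.
by have [[-> -> F]|[-> -> F]] := cyl_endpoints w; apply: F; rewrite ?ltr01.
Qed.

(** The turning point cuts [0, 1] in two, and the composite of branches carries
    this cut to the cylinder. Which child lies on the left depends on the
    orientation; here b is that child. *)
Lemma cyl_split w : exists b,
  [/\ cyl_lo phi (rcons w b) = cyl_lo phi w,
      cyl_hi phi (rcons w b) = cyl_lo phi (rcons w (~~ b)) &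
      cyl_hi phi (rcons w (~~ b)) = cyl_hi phi w].
Proof.
have [v0 v1] := andP (branch_turn gP).
have E c x : foldr phi x (rcons w c) = foldr phi (phi c x) w.
  by rewrite -cats1 foldr_cat.
rewrite /cyl_lo /cyl_hi.
have [inc|dec] := word_monotonic w; [exists false|exists true].
  have /ltW lt0 := inc 0 v in0 inv v0; have /ltW lt1 := inc v 1 inv in1 v1.
  have lt01 := le_trans lt0 lt1.
  rewrite !E !(branch1 gP) (branch_false0 gP) (branch_true0 gP).
  rewrite !(min_l lt0, min_l lt01, min_r lt1).
  by rewrite !(max_r lt0, max_l lt1, max_r lt01).
have /ltW lt0 := dec v 0 inv in0 v0; have /ltW lt1 := dec 1 v in1 inv v1.
have lt01 := le_trans lt1 lt0.
rewrite !E !(branch1 gP) (branch_false0 gP) (branch_true0 gP).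
rewrite !(min_r lt0, min_r lt01, min_l lt1).
by rewrite !(max_l lt0, max_r lt1, max_l lt01).
Qed.

Lemma cyl_length_splitting : splitting (cyl_length phi).
Proof.
split=> w; first by rewrite subr_gt0 cyl_lt.
have [b [lo mid hi]] := cyl_split w.
have -> : cyl_length phi w =
    cyl_length phi (rcons w b) + cyl_length phi (rcons w (~~ b)).
  by rewrite /cyl_length lo mid hi; ring.
by case: b {lo mid hi} => //=; rewrite addrC.
Qed.

Lemma cyl_descend n w x : x \in `[cyl_lo phi w, cyl_hi phi w] ->
  exists2 u, size u = n & x \in `[cyl_lo phi (w ++ u), cyl_hi phi (w ++ u)].
Proof.
elim: n w => [|n IHn] w xw; first by exists [::]; rewrite ?cats0.
suff [b /IHn[u un xu]] : exists b,
    x \in `[cyl_lo phi (rcons w b), cyl_hi phi (rcons w b)].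
  by exists (b :: u); rewrite /= ?un// -cat_rcons.
have [b [lo mid hi]] := cyl_split w; move: xw; rewrite in_itv/= => /andP[xl xh].
have [xm|mx] := leP x (cyl_hi phi (rcons w b)).
  by exists b; rewrite in_itv/= lo xl.
by exists (~~ b); rewrite in_itv/= -mid hi xh ltW.
Qed.

(** The branches are onto their sides of the turning point because g inverts
    them there. *)
Lemma word_onto_cyl w x : x \in `[cyl_lo phi w, cyl_hi phi w] ->
  exists2 y, y \in `[0, 1] & foldr phi y w = x.
Proof.
elim: w x => [|b w IHw] x.
  by rewrite /cyl_lo /cyl_hi /= min_l ?max_r// => x01; exists x.
rewrite in_itv/= => /andP[xlo xhi].
have F0 := word_in w in0; have F1 := word_in w in1.
have [lo01 hi01] : cyl_lo phi w \in `[0, 1] /\ cyl_hi phi w \in `[0, 1].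
  by have [[-> -> _]|[-> -> _]] := cyl_endpoints w.
have /ltW lohi := cyl_lt w.
suff [z zw <-] : exists2 z,
    z \in `[cyl_lo phi w, cyl_hi phi w] & phi b z = x.
  by have [y y01 <-] := IHw _ zw; exists y.
have ends : (cyl_lo phi (b :: w) = phi b (cyl_lo phi w) /\
             cyl_hi phi (b :: w) = phi b (cyl_hi phi w)) \/
            (cyl_lo phi (b :: w) = phi b (cyl_hi phi w) /\
             cyl_hi phi (b :: w) = phi b (cyl_lo phi w)).
  have [[-> -> _]|[-> -> _]] := cyl_endpoints w;
  have [[-> -> _]|[-> -> _]] := cyl_endpoints (b :: w);
  by [left|right].
have incE := le_mono_in (branch_inc gP).
have decE := le_nmono_in (branch_dec gP).
have [lo0 lo1] : 0 <= cyl_lo phi w /\ cyl_lo phi w <= 1.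
  by apply/andP; rewrite in_itv in lo01.
have [hi0 hi1] : 0 <= cyl_hi phi w /\ cyl_hi phi w <= 1.
  by apply/andP; rewrite in_itv in hi01.
have preim z : z \in `[0, 1] -> phi b z = x -> exists2 z,
    z \in `[cyl_lo phi w, cyl_hi phi w] & phi b z = x.
  move=> z01 zx; exists z => //; rewrite in_itv/=.
  move: ends xlo xhi; rewrite -zx.
  by case: b {zx} => -[[-> ->]|[-> ->]]; rewrite ?decE ?incE//; lra.
have v01 := inv; rewrite in_itv/= in v01; have /andP[v0 v1] := v01.
have x01 : x \in `[0, 1] by apply: (@cyl_in (b :: w)); rewrite in_itv/= xlo.
have /andP[x0 x1] : 0 <= x <= 1 by rewrite in_itv in x01.
apply: (preim (g x)); first exact: (branch_map gP).
case: b {preim} xlo xhi ends => xlo xhi ends.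
  apply: (branch_trueK gP); rewrite in_itv/= x1 andbT.
  rewrite -(branch1 gP true); apply: le_trans xlo.
  by case: ends => -[-> _]; rewrite decE.
apply: (branch_falseK gP); rewrite in_itv/= x0/=.
rewrite -(branch1 gP false); apply: (le_trans xhi).
by case: ends => -[_ ->]; rewrite incE.
Qed.

Lemma cyl_interior w x : cyl_lo phi w < x < cyl_hi phi w ->
  exists2 y, 0 < y < 1 & foldr phi y w = x.
Proof.
move=> /andP[xlo xhi]; have [|y y01 yx] := @word_onto_cyl w x.
  by rewrite in_itv/= !ltW.
exists y => //; move: y01; rewrite in_itv/= !le_eqVlt => /andP[y0 y1].
apply/andP; split.
  case/predU1P: y0 => // y0; move: xlo xhi; rewrite -yx -y0.
  by have [[-> -> _]|[-> -> _]] := cyl_endpoints w; rewrite ltxx.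
case/predU1P: y1 => // y1; move: xlo xhi; rewrite -yx y1.
by have [[-> -> _]|[-> -> _]] := cyl_endpoints w; rewrite ltxx.
Qed.

Lemma iter_word w y n : y \in `[0, 1] -> (n <= size w)%N ->
  iter n g (foldr phi y w) = foldr phi y (drop n w).
Proof.
move=> y01; elim: n w => [|n IHn] w nw; first by rewrite drop0.
by case: w nw => // b w nw; rewrite iterSr /= (branchK gP) ?word_in// IHn.
Qed.

Lemma word_interior w y : 0 < y < 1 -> 0 < foldr phi y w < 1.
Proof.
move=> y01; have [v0 v1] := andP (branch_turn gP).
elim: w => //= b w /andP[]; move: (foldr _ _ _) => z z0 z1.
have z01 : z \in `[0, 1] by rewrite in_itv/= !ltW.
case: b.
  have := branch_dec gP z01 in0 z0; have := branch_dec gP in1 z01 z1.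
  rewrite (branch1 gP) (branch_true0 gP) => vz ->.
  by rewrite (lt_trans v0).
have := branch_inc gP in0 z01 z0; have := branch_inc gP z01 in1 z1.
rewrite (branch1 gP) (branch_false0 gP) => zv ->.
by rewrite (lt_trans zv).
Qed.

(** Each kink is a zero of some iterate of g, and there are finitely many among
    the nodes of a subdivision of g. Inside the cylinder of w the iterates of
    order at most size w have no zero, so long words see no kink. *)
Lemma firm_affine_on_cyl : firm_carcass g ->
  exists N, forall w, (N <= size w)%N ->
    affine_on (cyl_lo phi w) (cyl_hi phi w) g.
Proof.
move=> [[gu [s s01 gs]] firm].
have g0 : g 0 = 0 by case: gu => _ _ [? _ []].
(* N bounds the order of the zeros among the kinks of g *)
have [N Ns] : exists N, {in s, forall x, x \in `]0, 1[ ->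
    ~ derivable g x 1 -> exists2 n, (n <= N)%N & iter n g x = 0}.
  elim: {s01 gs} s => [|a s [N IHs]]; first by exists 0%N.
  have [aK|aK] := pselect (zero_preimages g a).
    case: aK => m _ [_ gm]; exists (maxn m N) => x.
    rewrite inE => /predU1P[-> _ _|xs x01 xder].
      by exists m => //; rewrite leq_maxl.
    have [n nN gn] := IHs x xs x01 xder.
    by exists n => //; rewrite leq_max nN orbT.
  exists N => x; rewrite inE => /predU1P[-> a01 ader|]; last exact: IHs.
  by case: aK; apply: firm; split.
exists N => w Nw.
have lo01 := word_in w in0; have hi01 := word_in w in1.
have [lo0 hi1] : 0 <= cyl_lo phi w /\ cyl_hi phi w <= 1.
  move: lo01 hi01; rewrite !in_itv/=.
  by have [[-> -> _]|[-> -> _]] := cyl_endpoints w => /andP[? ?] /andP[].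
apply: (pieces_derivable_affine_on s01) => //; first exact: cyl_lt.
move=> x xs /cyl_interior[y y01 yx].
have yin : y \in `[0, 1] by rewrite in_itv/=; case/andP: y01 => /ltW-> /ltW.
have [//|xder] := pselect (derivable g x 1).
have [|n nN gnx] := Ns x xs _ xder; first by rewrite -yx in_itv/= word_interior.
have := word_interior (drop n w) y01.
by rewrite -iter_word ?(leq_trans nN)// yx gnx ltxx.
Qed.

Lemma cyl_length_word w : cyl_length phi w = `|foldr phi 1 w - foldr phi 0 w|.
Proof.
have := cyl_lt w; rewrite /cyl_length.
have [[-> -> _]|[-> -> _]] := cyl_endpoints w => lt.
  by rewrite gtr0_norm// subr_gt0.
by rewrite ltr0_norm ?opprB// subr_lt0.
Qed.

(** As g maps the cylinder of b :: w onto that of w, removing a letter in front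
    of a long word rescales all lengths below it by the slope of g there. *)
Lemma firm_self_similar : firm_carcass g ->
  exists N, forall M, (N <= M)%N -> self_similar M (cyl_length phi).
Proof.
move=> /firm_affine_on_cyl[N aff]; exists N => M NM w z zM.
have [l0 _] := cyl_length_splitting.
elim: w => [|b w [k k0 kE]]; first by exists 1 => // u; rewrite mul1r.
have [|m [c gE]] := aff (b :: w ++ z).
  by rewrite /= size_cat zM leqW// (leq_trans NM)// leq_addl.
have step u : cyl_length phi (w ++ z ++ u) =
    `|m| * cyl_length phi (b :: w ++ z ++ u).
  have E y : y \in `[0, 1] -> foldr phi y (w ++ z ++ u) =
      m * foldr phi y (b :: w ++ z ++ u) + c.
    move=> y01; rewrite -gE; first by rewrite /= (branchK gP) ?word_in.
    rewrite catA -cat_cons foldr_cat.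
    by apply: word_in_cyl; exact: word_in.
  rewrite !cyl_length_word -normrM !E//; congr `|_|; ring.
have m0 : 0 < `|m|.
  rewrite lt_neqAle normr_ge0 andbT; apply/eqP => m0.
  by have := l0 (w ++ z ++ [::]); rewrite step -m0 mul0r ltxx.
exists (`|m|^-1 * k) => [|u]; first by rewrite mulr_gt0 ?invr_gt0.
by rewrite -mulrA -kE step mulKf// gt_eqF.
Qed.

End cylinders.
End inverse_branches.

(** * The conjugacy on the cylinders *)

Section conjugacy_of_firm_carcasses.
Context {R : realType}.
Set Implicit Arguments.
Unset Strict Implicit.
Implicit Types (g h : R -> R) (v x y : R) (phi : bool -> R -> R).
Implicit Types (w u : seq bool) (b : bool).

Let in0 : (0 : R) \in `[0, 1]. Proof. by rewrite in_itv/= lexx ler01. Qed.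
Let in1 : (1 : R) \in `[0, 1]. Proof. by rewrite in_itv/= lexx ler01. Qed.

(** A decreasing h would exchange 0 and 1, but 0 is a fixed point of
    both maps and 1 is not. *)
Lemma conjugacy_increasing g1 g2 h : unimodal g1 -> unimodal g2 ->
  conjugacy g1 g2 h ->
  [/\ {in `[0, 1] &, {homo h : x y / x < y}}, h 0 = 0 & h 1 = 1].
Proof.
move=> [_ _ [v1 _ [_ _ g10 _ _]]] [_ _ [v2 _ [_ _ _ g21 _]]].
move=> [[hin hcont [k [kin _ hK kK]]] hg].
have hinj : {in `[0, 1] &, injective h}.
  by apply: (can_in_inj (g := k)) => x x01; apply: hK; rewrite inE.
have h01 x : x \in `[0, 1] -> 0 <= h x <= 1 by move=> /hin; rewrite /= in_itv.
have onto y : y \in `[0, 1] -> exists2 x, x \in `[0, 1] & h x = y.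
  by move=> y01; exists (k y); [exact: kin|apply: kK; rewrite inE].
have /andP[h0ge h0le] := h01 _ in0; have /andP[h1ge h1le] := h01 _ in1.
have [x0 /[dup] x0in + hx0] := onto _ in0.
have [x1 /[dup] x1in + hx1] := onto _ in1.
rewrite !in_itv/= => /andP[x1ge x1le] /andP[x0ge x0le].
have [inc|dec] := itv_continuous_inj_mono hcont hinj.
  have incE := le_mono_in inc; split => //; apply/eqP; rewrite eq_le.
    by rewrite h0ge andbT -[leRHS]hx0 incE.
  by rewrite h1le -[leLHS]hx1 incE.
have decE := le_nmono_in dec.
have h0 : h 0 = 1.
  by apply/eqP; rewrite eq_le h0le -[leLHS]hx1 decE.
have h1 : h 1 = 0.
  by apply/eqP; rewrite eq_le h1ge andbT -[leRHS]hx0 decE.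
have := hg 0 in0; rewrite g10 h0 g21 => /eqP.
by rewrite oner_eq0.
Qed.

Section conjugate_branches.
Context g1 g2 h v1 v2 phi1 phi2.
Hypotheses (g1P : inverse_branches g1 v1 phi1).
Hypotheses (g2P : inverse_branches g2 v2 phi2).
Hypotheses (hin : {homo h : x / x \in `[0, 1]}).
Hypotheses (hg : {in `[0, 1], forall x, h (g1 x) = g2 (h x)}).
Hypotheses (hinc : {in `[0, 1] &, {homo h : x y / x < y}}).
Hypotheses (h0 : h 0 = 0) (h1 : h 1 = 1).

Let hincE := le_mono_in hinc.

Lemma conjugacy_branch b y : y \in `[0, 1] -> h (phi1 b y) = phi2 b (h y).
Proof.
have v1in : v1 \in `[0, 1] by rewrite -(branch1 g1P true) (branch_in g1P).
have hv1in := hin v1in.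
have /andP[hv0 hv1] : 0 <= h v1 <= 1 by rewrite in_itv in hv1in.
(* v2 is the only point that g2 maps to 1 *)
have hv : h v1 = v2.
  have gv : g2 (h v1) = 1.
    by rewrite -hg// -(branch1 g1P true) (branchK g1P).
  have [hv|/ltW hv] := leP (h v1) v2.
    have := branch_falseK g2P (x := h v1); rewrite gv (branch1 g2P) => -> //.
    by rewrite in_itv/= hv0.
  have := branch_trueK g2P (x := h v1); rewrite gv (branch1 g2P) => -> //.
  by rewrite in_itv/= hv.
move=> y01; have py := branch_in g1P b y01; have hpy := hin py.
have /andP[hpy0 hpy1] : 0 <= h (phi1 b y) <= 1 by rewrite in_itv in hpy.
have gE : g2 (h (phi1 b y)) = h y by rewrite -hg// (branchK g1P).
have y1 : y <= 1 by move: y01; rewrite in_itv/= => /andP[].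
rewrite -gE; case: b py {hpy gE} hpy0 hpy1 => py hpy0 hpy1.
  rewrite (branch_trueK g2P)// in_itv/= hpy1 andbT -hv hincE//.
  by rewrite -(branch1 g1P true) (le_nmono_in (branch_dec g1P)).
rewrite (branch_falseK g2P)// in_itv/= hpy0/= -hv hincE//.
by rewrite -(branch1 g1P false) (le_mono_in (branch_inc g1P)).
Qed.

Lemma conjugacy_word w y : y \in `[0, 1] ->
  h (foldr phi1 y w) = foldr phi2 (h y) w.
Proof.
move=> y01; elim: w => //= b w IHw.
by rewrite conjugacy_branch ?IHw// (word_in g1P).
Qed.

Lemma conjugacy_cyl w :
  h (cyl_lo phi1 w) = cyl_lo phi2 w /\ h (cyl_hi phi1 w) = cyl_hi phi2 w.
Proof.
have lo2 := cyl_lt g2P w.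
have F0 := word_in g1P w in0; have F1 := word_in g1P w in1.
have [[-> -> F]|[-> -> F]] := cyl_endpoints g1P w.
  have := hinc F0 F1 (F _ _ in0 in1 ltr01).
  rewrite /cyl_lo /cyl_hi !conjugacy_word// h0 h1 => /ltW lt.
  by rewrite min_l// max_r.
have := hinc F1 F0 (F _ _ in1 in0 ltr01).
rewrite /cyl_lo /cyl_hi !conjugacy_word// h0 h1 => /ltW lt.
by rewrite min_r// max_l.
Qed.

Let l1 := cyl_length phi1.
Let l2 := cyl_length phi2.

Lemma cyl_in01 w : cyl_lo phi1 w \in `[0, 1] /\ cyl_hi phi1 w \in `[0, 1].
Proof.
have /ltW lt := cyl_lt g1P w.
by split; apply: (cyl_in g1P (w := w)); rewrite in_itv/= lexx lt.
Qed.

(** The partition into the cylinders of depth n below w; it is built along the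
    tree, so that the words need not be sorted by position. *)
Lemma cyl_polygonal_length n w : exists2 s,
  itv_partition (cyl_lo phi1 w) (cyl_hi phi1 w) s &
  l1 w + l2 w - Num.sqrt 2 * affinity l1 l2 n w <=
    polygonal_length (cyl_lo phi1 w) (cyl_hi phi1 w) h s.
Proof.
elim: n w => [|n IHn] w.
  exists [:: cyl_hi phi1 w]; first exact/itv_partition1/(cyl_lt g1P).
  have [hlo hhi] := conjugacy_cyl w.
  rewrite polygonal_length_cons polygonal_length_nil addr0 hlo hhi.
  by apply: sqrt_sum_ge_add; rewrite subr_ge0 ltW ?(cyl_lt g1P) ?(cyl_lt g2P).
have [b [lo mid hi]] := cyl_split g1P w.
have [s sP sl] := IHn (rcons w b); have [t tP tl] := IHn (rcons w (~~ b)).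
rewrite lo mid in sP sl; rewrite hi in tP tl.
exists (s ++ t); first exact: itv_partition_cat tP.
rewrite (polygonal_length_cat _ _ _ sP); apply: le_trans (lerD sl tl).
have [_ l1D] := cyl_length_splitting g1P.
have [_ l2D] := cyl_length_splitting g2P.
rewrite /l1 /l2 (l1D w) (l2D w) -/l1 -/l2 /=.
by case: b {lo mid hi sP sl tP tl}; rewrite /=; lra.
Qed.

Lemma cyl_piecewise_linear n w :
  (forall u, size u = n ->
     affine_on (cyl_lo phi1 (w ++ u)) (cyl_hi phi1 (w ++ u)) h) ->
  piecewise_linear (cyl_lo phi1 w) (cyl_hi phi1 w) h.
Proof.
elim: n w => [|n IHn] w aff.
  apply: piecewise_linear_affine; first exact: (cyl_lt g1P).
  by have := aff [::] erefl; rewrite cats0.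
have pl c :
    piecewise_linear (cyl_lo phi1 (rcons w c)) (cyl_hi phi1 (rcons w c)) h.
  by apply: IHn => u un; rewrite cat_rcons; apply: aff; rewrite /= un.
have [b [lo mid hi]] := cyl_split g1P w.
have := pl b; have := pl (~~ b); rewrite lo hi mid => pr pl'.
exact: piecewise_linear_cat pr.
Qed.

(** Equal splits make h affine on the endpoints of the cylinders below w. These
    are dense because the cylinders shrink, and a monotone function that is
    affine on a dense set is affine. *)
Lemma balanced_affine_on_cyl N w : self_similar N l1 -> (N <= size w)%N ->
  (forall u, l1 (rcons (w ++ u) false) * l2 (rcons (w ++ u) true) =
             l1 (rcons (w ++ u) true) * l2 (rcons (w ++ u) false)) ->
  affine_on (cyl_lo phi1 w) (cyl_hi phi1 w) h.
Proof.
move=> ssl Nw bal.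
have sl1 := cyl_length_splitting g1P; have sl2 := cyl_length_splitting g2P.
have prop := balanced_proportional sl1 sl2 bal.
set k := l2 w / l1 w in prop.
have k0 : 0 < k by rewrite divr_gt0 ?sl1.1 ?sl2.1.
pose c := h (cyl_lo phi1 w) - k * cyl_lo phi1 w.
have lenE u : h (cyl_hi phi1 (w ++ u)) - h (cyl_lo phi1 (w ++ u)) =
    k * (cyl_hi phi1 (w ++ u) - cyl_lo phi1 (w ++ u)).
  by have [-> ->] := conjugacy_cyl (w ++ u); exact: prop.
have lohi u : h (cyl_lo phi1 (w ++ u)) = k * cyl_lo phi1 (w ++ u) + c /\
              h (cyl_hi phi1 (w ++ u)) = k * cyl_hi phi1 (w ++ u) + c.
  suff loE : h (cyl_lo phi1 (w ++ u)) = k * cyl_lo phi1 (w ++ u) + c.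
    by split => //; have := lenE u; lra.
  elim/last_ind: u => [|u a IHu]; first by rewrite cats0 /c; ring.
  rewrite -rcons_cat.
  have [b [lo mid hi]] := cyl_split g1P (w ++ u).
  have [->|ab] := eqVneq a b; first by rewrite lo.
  have -> : a = ~~ b by case: a b ab {lo mid hi} => -[].
  rewrite -mid; have := lenE (rcons u b); rewrite -rcons_cat lo.
  by lra.
exists k, c => x xw; apply/eqP; rewrite -subr_eq0 -normr_eq0 eq_le normr_ge0.
rewrite andbT; apply/ler_addgt0Pr => e e0; rewrite add0r.
have [n small] := splitting_shrink sl1 ssl Nw (divr_gt0 e0 k0).
have [u un xu] := cyl_descend g1P n xw.
have := small u un; rewrite ltr_pdivlMr// /cyl_length => lt_e.
have [lo01 hi01] := cyl_in01 (w ++ u).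
have x01 := cyl_in g1P xu.
move: xu; rewrite in_itv/= => /andP[xlo xhi].
have [loE hiE] := lohi u.
have hlo : h (cyl_lo phi1 (w ++ u)) <= h x by rewrite hincE.
have hhi : h x <= h (cyl_hi phi1 (w ++ u)) by rewrite hincE.
have := ler_wpM2l (ltW k0) xlo; have := ler_wpM2l (ltW k0) xhi.
rewrite ler_norml; lra.
Qed.

End conjugate_branches.
End conjugacy_of_firm_carcasses.

(** * The length of the graph *)

Theorem theorem5 (R : realType) (g1 g2 h : R -> R)
    (g1_firm : firm_carcass g1) (g2_firm : firm_carcass g2)
    (h_conj : conjugacy g1 g2 h) (h_not_pl : ~ piecewise_linear 0 1 h) :
  graph_length 0 1 h = 2%:E.
Proof.
have g1u : unimodal g1 by case: g1_firm => -[].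
have g2u : unimodal g2 by case: g2_firm => -[].
have [hinc h0 h1] := conjugacy_increasing g1u g2u h_conj.
have [[hin _ _] hg] := h_conj.
have [v1 [phi1 g1P]] := unimodal_inverse_branches g1u.
have [v2 [phi2 g2P]] := unimodal_inverse_branches g2u.
have lo0 (phi : bool -> R -> R) : cyl_lo phi [::] = 0 by rewrite /cyl_lo min_l.
have hi1 (phi : bool -> R -> R) : cyl_hi phi [::] = 1 by rewrite /cyl_hi max_r.
set l1 := cyl_length phi1; set l2 := cyl_length phi2.
have [N1 ss1] := firm_self_similar g1P g1_firm.
have [N2 ss2] := firm_self_similar g2P g2_firm.
pose N := maxn N1 N2.
have ssl1 : self_similar N l1 by apply: ss1; exact: leq_maxl.
have ssl2 : self_similar N l2 by apply: ss2; exact: leq_maxr.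
have [w0 Nw0 unbal] : exists2 w, (N <= size w)%N &
    l1 (rcons w false) * l2 (rcons w true) !=
    l1 (rcons w true) * l2 (rcons w false).
  apply: contrapT => bal; apply: h_not_pl.
  rewrite -(lo0 phi1) -(hi1 phi1).
  apply: (cyl_piecewise_linear g1P (n := N)) => w wN; rewrite cat0s.
  apply: (balanced_affine_on_cyl g1P g2P hin hg hinc h0 h1 ssl1).
    by rewrite wN.
  move=> u; apply/eqP; apply: contraT => neq.
  case: bal; exists (w ++ u) => //.
  by rewrite size_cat wN leq_addr.
apply/eqP; rewrite eq_le; apply/andP; split.
  apply: ge_ereal_sup => _ [s s01 <-]; rewrite lee_fin.
  apply: le_trans (polygonal_length_le _ s01) _; last by rewrite h0 h1; lra.
  by move=> x y x01 y01; rewrite (le_mono_in hinc).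
apply/lee_addgt0Pr => e e0.
have sq2 : 0 < Num.sqrt 2 :> R by rewrite sqrtr_gt0.
have [n small] := affinity_vanishes (cyl_length_splitting g1P)
  (cyl_length_splitting g2P) ssl1 ssl2 Nw0 unbal (divr_gt0 e0 sq2).
have [s s01 sl] := cyl_polygonal_length g1P g2P hin hg hinc h0 h1 n [::].
rewrite !lo0 !hi1 in s01 sl.
apply: (@le_trans _ _ ((polygonal_length 0 1 h s)%:E + e%:E)%E); last first.
  by apply: leeD => //; apply: ereal_sup_ubound; exists s.
rewrite -EFinD lee_fin -lerBlDr; apply: le_trans sl.
rewrite /cyl_length !lo0 !hi1; move: small; rewrite ltr_pdivlMr// /l1 /l2; lra.
Qed.
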